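(* Let $(X,\mathbb{A},d)$ be a $C^{\ast}$-algebra valued metric space and let $C_{x_0,r}^{C^{\ast}}$ be any circle on $X$ (with $x_0\in X$, $r\in\mathbb{A}_+$). Define $\varphi:X\to\mathbb{A}_+$ by $\varphi(x)=d(x,x_0)$ for all $x\in X$. If $T:X\to X$ is a self-mapping satisfying $$d(x,Tx)\preceq \varphi(x)+\varphi(Tx)-2r\qquad\text{and}\qquad d(Tx,x_0)\preceq r$$ for all $x\in C_{x_0,r}^{C^{\ast}}$, then the circle $C_{x_0,r}^{C^{\ast}}$ is a fixed circle of $T$.
   Context: $\mathbb{A}$ is a unital $C^{\ast}$-algebra with unit $I$ and zero element $\theta$. $\mathbb{A}_h=\{a\in\mathbb{A}: a=a^{\ast}\}$. An element $a\in\mathbb{A}$ is positive, written $\theta\preceq a$, if $a\in\mathbb{A}_h$ and its spectrum is contained in $[0,\infty)$; $\mathbb{A}_+$ is the set of positive elements (so $\theta\in\mathbb{A}_+$). For $a,b\in\mathbb{A}_h$, $a\preceq b$ means $b-a\in\mathbb{A}_+$. A $C^{\ast}$-algebra valued metric space $(X,\mathbb{A},d)$ is a nonempty set $X$ with a map $d:X\times X\to\mathbb{A}$ such that for all $x,y,z\in X$: (i) $\theta\preceq d(x,y)$, and $d(x,y)=\theta$ if and only if $x=y$; (ii) $d(x,y)=d(y,x)$; (iii) $d(x,y)\preceq d(x,z)+d(z,y)$. For $x_0\in X$ and $r\in\mathbb{A}_+$, the circle with center $x_0$ and radius $r$ is $C_{x_0,r}^{C^{\ast}}=\{x\in X: d(x,x_0)=r\}$.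 For a self-mapping $T:X\to X$, the circle $C_{x_0,r}^{C^{\ast}}$ is called a fixed circle of $T$ if $Tx=x$ for all $x\in C_{x_0,r}^{C^{\ast}}$. *)

(* Defs.v *)
From HB Require Import structures.
From mathcomp Require Import all_boot all_order all_algebra.
From mathcomp Require Import complex.
From mathcomp Require Import all_classical all_reals all_analysis.

Set Implicit Arguments.
Unset Strict Implicit.
Unset Printing Implicit Defensive.

Import Order.TTheory GRing.Theory Num.Theory.
Import numFieldNormedType.Exports.

Local Open Scope classical_set_scope.
Local Open Scope complex_scope.
Local Open Scope ring_scope.

(* The hierarchy has no join of rings and normed modules below the number
   domains, so the product and the unit are part of the mixin, and the ring
   structure is declared afterwards, on the same additive group. The ring is a
   [pzRingType]: the zero algebra is allowed, and [`|1| = 1] is not an axiom (it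
   follows from the C*-identity when [1 != 0]). The norm takes its values in the
   nonnegative reals of [R[i]]. *)
HB.mixin Record CompleteNormedModule_isUnitalCStarAlgebra (R : realType) A
    of CompleteNormedModule R[i] A := {
  cstar_one : A ;
  cstar_mul : A -> A -> A ;
  cstar_mulA : associative cstar_mul ;
  cstar_mul1r : left_id cstar_one cstar_mul ;
  cstar_mulr1 : right_id cstar_one cstar_mul ;
  cstar_mulDl : left_distributive cstar_mul +%R ;
  cstar_mulDr : right_distributive cstar_mul +%R ;
  cstar_scalerAl : forall (l : R[i]) (a b : A),
    l *: cstar_mul a b = cstar_mul (l *: a) b ;
  cstar_scalerAr : forall (l : R[i]) (a b : A),
    l *: cstar_mul a b = cstar_mul a (l *: b) ;
  cstar_normM : forall a b : A, `|cstar_mul a b| <= `|a| * `|b| ;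
  star : A -> A ;
  starK : involutive star ;
  starD : {morph star : a b / a + b} ;
  starZ : forall (l : R[i]) (a : A), star (l *: a) = Num.conj l *: star a ;
  starM : forall a b : A, star (cstar_mul a b) = cstar_mul (star b) (star a) ;
  cstar_identity : forall a : A, `|cstar_mul (star a) a| = `|a| ^+ 2
}.

#[short(type="unitalCStarAlgType")]
HB.structure Definition UnitalCStarAlgebra (R : realType) :=
  {A of CompleteNormedModule R[i] A
      & CompleteNormedModule_isUnitalCStarAlgebra R A}.

HB.instance Definition _ (R : realType) (A : unitalCStarAlgType R) :=
  GRing.Zmodule_isPzRing.Build (UnitalCStarAlgebra.sort A)
    (@cstar_mulA R A) (@cstar_mul1r R A) (@cstar_mulr1 R A)
    (@cstar_mulDl R A) (@cstar_mulDr R A).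

Section PositiveElements.
Context {R : realType} {A : unitalCStarAlgType R}.
Implicit Types a b : A.

Definition selfadjoint : set A := [set a | star a = a].

Definition invertible a : Prop := exists b, a * b = 1 /\ b * a = 1.

Definition spectrum a : set R[i] := [set l : R[i] | ~ invertible (l *: (1 : A) - a)].

(* In [R[i]], [0 <= l] says that [l] is real and nonnegative. *)
Definition positive : set A :=
  [set a | selfadjoint a /\ spectrum a `<=` [set l | 0 <= l]].

Definition cstar_le a b : Prop :=
  [/\ selfadjoint a, selfadjoint b & positive (b - a)].

End PositiveElements.

Notation "a ⪯ b" := (cstar_le a b) (at level 70, no associativity) : ring_scope.

Section CStarMetric.
Context {R : realType} {A : unitalCStarAlgType R} {X : Type}.

Record cstar_metric (d : X -> X -> A) : Prop := CStarMetric {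
  cmetric_nonempty : inhabited X ;
  cmetric_ge0 : forall x y, 0 ⪯ d x y ;
  cmetric_eq0 : forall x y, d x y = 0 <-> x = y ;
  cmetric_sym : forall x y, d x y = d y x ;
  cmetric_triangle : forall x y z, d x y ⪯ d x z + d z y
}.

Definition circle (d : X -> X -> A) (x0 : X) (r : A) : set X :=
  [set x | d x x0 = r].

Definition fixed_circle (d : X -> X -> A) (x0 : X) (r : A) (T : X -> X) : Prop :=
  forall x, circle d x0 r x -> T x = x.

End CStarMetric.

(* Main.v *)
Require Import Defs.
From HB Require Import structures.
From mathcomp Require Import all_boot all_order all_algebra.
From mathcomp Require Import complex.
From mathcomp Require Import all_classical all_reals all_analysis.
Import Order.TTheory GRing.Theory Num.Theory.
Import numFieldNormedType.Exports.
Local Open Scope ring_scope.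

(** Fix [x] on the circle and put [p = d x (T x)] and [s = r - d (T x) x0]. The
    first hypothesis on [T] says exactly that [- (p + s)] is positive. The
    triangle inequality [d (T x) x0 ⪯ d (T x) x + d x x0] says that [p + s] is
    positive. So antisymmetry of the order ([positive_anti]) gives [p = - s];
    since [p] and, by the second hypothesis, [s] are positive, antisymmetry
    again gives [p = 0], that is, [T x = x]. The triangle inequality spares the
    theorem that a sum of two positive elements is positive.

    If [a] and [- a] are positive then the spectrum of [a] is contained in
    [{0}], so it is enough that a selfadjoint [a != 0] has a nonzero
    spectral value. Usually this comes from the spectral radius formula, which rests on
    complex analysis. The C*-identity gives it by algebra alone. Scale [a] to
    norm [1]; then [1 - a ^+ 2 = (1 - a) (1 + a)] would be invertible, and its
    inverse would bound the partial products of the formal expansion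

      (1 - a^2)^-1 = (1 + a^2) (1 + a^4) (1 + a^8) ...

    uniformly in norm, because the product of the first [n] factors times
    [1 - a ^+ 2] telescopes to [1 - a ^+ (2 ^ n.+1)], of norm at most [2]. But
    the product of the first [n] factors has norm at least [2 ^+ n]
    ([norm_dyadic_prod_ge]): the square of [1 + b ^+ 2] is
    [(1 - b ^+ 2) ^+ 2 + (b *+ 2) ^+ 2], and the norm of a sum of squares of two
    commuting selfadjoint elements is at least that of each summand
    ([norm_sum_sqr_ge]). *)

Set Implicit Arguments.
Unset Strict Implicit.
Unset Printing Implicit Defensive.

Lemma sqrD_comm (S : pzRingType) (p q : S) :
  GRing.comm p q -> (p + q) * (p + q) = (p - q) * (p - q) + (p * q) *+ 4.
Proof.
move=> cpq; set d := p - q.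
have pE : p = d + q by rewrite /d subrK.
have cdq : q * d = d * q by rewrite /d mulrBr mulrBl cpq.
rewrite pE; clearbody d; rewrite -addrA !mulrDl !mulrDr cdq mulrnDl.
by rewrite !mulrSr mulr0n !add0r !addrA !(addrAC _ (q * q) (d * q)).
Qed.

(** * Norm and involution in a C*-algebra *)

Section CStarAlgebra.
Context {R : realType} {A : unitalCStarAlgType R}.
Implicit Types a b h k y : A.

Lemma mul_scalel (l : R[i]) a b : (l *: a) * b = l *: (a * b).
Proof. exact: esym (cstar_scalerAl l a b). Qed.

Lemma mul_scaler (l : R[i]) a b : a * (l *: b) = l *: (a * b).
Proof. exact: esym (cstar_scalerAr l a b). Qed.

Lemma norm_mul_le a b : `|a * b| <= `|a| * `|b|.
Proof. exact: cstar_normM. Qed.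

Lemma star_mul a b : star (a * b) = star b * star a.
Proof. exact: starM. Qed.

Lemma star0 : star (0 : A) = 0.
Proof. by apply: (addrI (star 0)); rewrite -starD !addr0. Qed.

Lemma starN a : star (- a) = - star a.
Proof. by apply: (addrI (star a)); rewrite -starD !subrr star0. Qed.

Lemma star1 : star (1 : A) = 1.
Proof. by rewrite -[star 1]mul1r -{1}(starK (1 : A)) -star_mul mul1r starK. Qed.

Lemma selfadjointD a b :
  selfadjoint a -> selfadjoint b -> selfadjoint (a + b).
Proof. by rewrite /selfadjoint /= starD => -> ->. Qed.

Lemma selfadjointN a : selfadjoint a -> selfadjoint (- a).
Proof. by rewrite /selfadjoint /= starN => ->. Qed.

Lemma selfadjointM a b :
  GRing.comm a b -> selfadjoint a -> selfadjoint b -> selfadjoint (a * b).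
Proof. by rewrite /selfadjoint /= star_mul => cab -> ->. Qed.

Lemma selfadjointX a n : selfadjoint a -> selfadjoint (a ^+ n).
Proof.
move=> sa; elim: n => [|n IHn]; first exact: star1.
by rewrite exprS; apply: selfadjointM => //; apply: commrX.
Qed.

(** The C*-identity gives [`|b| ^+ 2 <= `|star b| * `|b|], hence one inequality
    for every [b]; its instance at [star a] is the other one. *)
Lemma norm_star a : `|star a| = `|a|.
Proof.
have le_star b : `|b| <= `|star b|.
  have [->|b0] := eqVneq b 0; first by rewrite normr0.
  rewrite -(ler_pM2r (_ : 0 < `|b|)) ?normr_gt0// -expr2 -cstar_identity.
  exact: norm_mul_le.
by apply/eqP; rewrite eq_le le_star andbT -{2}[a]starK le_star.
Qed.

Lemma norm_sqr a : selfadjoint a -> `|a * a| = `|a| ^+ 2.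
Proof. by move=> sa; rewrite -cstar_identity sa. Qed.

(** The sum of squares is [star z * z] for the normal element [z = h + 'i *: k],
    and [h] is the real part of [z], so that [`|h| <= `|z|]. *)
Lemma norm_sum_sqr_ge h k :
  GRing.comm h k -> selfadjoint h -> selfadjoint k ->
  `|h| ^+ 2 <= `|h * h + k * k|.
Proof.
move=> chk sh sk; set z := h + 'i *: k.
have starz : star z = h - 'i *: k.
  by rewrite /z starD starZ conjCi scaleNr sh sk.
have zz : star z * z = h * h + k * k.
  rewrite starz /z mulrDr !mulrBl !mul_scalel !mul_scaler chk addrA subrK.
  by rewrite scalerA -(expr2 'i) sqrCi scaleN1r opprK.
rewrite -zz cstar_identity lerXn2r ?nnegrE//.
have h2 : h *+ 2 = z + star z.
  by rewrite starz /z addrACA subrr addr0 mulr2n.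
rewrite -(ler_pMn2r (_ : 0 < 2)%N)// -normrMn h2.
by rewrite (le_trans (ler_normD _ _))// norm_star mulr2n.
Qed.

(** The inequality [(1 + t ^+ 2) ^+ 2 >= (t *+ 2) ^+ 2] behind the mean
    inequality, read on norms: the difference of the two sides is a square, so
    [norm_sum_sqr_ge] applies. The factor [y] allows the estimate to be
    iterated along a product. *)
Lemma norm_mul_1Dsqr_ge a y :
  GRing.comm a y -> selfadjoint a -> selfadjoint y ->
  2 * `|y * a| <= `|y * (1 + a * a)|.
Proof.
move=> cay sa sy.
have caa : GRing.comm a (a * a) by apply: commrM.
have cyaa : GRing.comm y (a * a) by apply: commrM; apply: commr_sym.
have saa : selfadjoint (a * a) by apply: selfadjointM.
have s1 : selfadjoint (1 : A) by exact: star1.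
set u := (y * a) *+ 2; set v := y * (1 - a * a); set w := y * (1 + a * a).
have sw : selfadjoint w.
  apply: selfadjointM => //; last exact: selfadjointD.
  by apply: commrD => //; apply: commr1.
have sv : selfadjoint v.
  apply: selfadjointM => //; first by apply: commrB => //; apply: commr1.
  by apply: selfadjointD => //; apply: selfadjointN.
have sya : selfadjoint (y * a) by apply: selfadjointM => //; apply: commr_sym.
have su : selfadjoint u by rewrite /u mulr2n; apply: selfadjointD.
have cuv : GRing.comm u v.
  have cya : GRing.comm y (y * a) by apply: commrM => //; exact/commr_sym.
  have caya : GRing.comm a (y * a) by apply: commrM.
  rewrite /u /v; apply/commr_sym/commrMn/commr_sym/commrM; first exact/commr_sym.
  by apply: commrB; [apply: commr1|apply: commrM; exact/commr_sym].
have ww : w * w = u * u + v * v.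
  rewrite /w /v /u mulrDr mulrBr mulr1 mulrnAl mulrnAr -mulrnA.
  have -> : y * a * (y * a) = y * (y * (a * a)).
    by rewrite -mulrA (mulrA a) cay !mulrA.
  set q := y * (a * a).
  have cyq : GRing.comm y q by apply: commrM.
  by rewrite (sqrD_comm cyq) addrC.
rewrite mulr_natl -normrMn -[leLHS]/`|u|.
by rewrite -[_ <= _](@ler_pXn2r _ 2) ?nnegrE// -[leRHS]norm_sqr// ww norm_sum_sqr_ge.
Qed.

(** * Dyadic partial products of the inverse of 1 - a^2 *)

Definition dyadic_prod a n : A := \prod_(j < n) (1 + a ^+ (2 ^ j.+1)).

Lemma comm_dyadic_prod a n : GRing.comm a (dyadic_prod a n).
Proof.
by apply: commr_prod => j _; apply: commrD; [apply: commr1|apply: commrX].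
Qed.

Lemma selfadjoint_dyadic_prod a n :
  selfadjoint a -> selfadjoint (dyadic_prod a n).
Proof.
move=> sa; rewrite /dyadic_prod.
elim: n => [|n IHn]; first by rewrite big_ord0; exact: star1.
rewrite big_ord_recr /=; apply: selfadjointM => //.
  apply: commrD; first exact: commr1.
  by apply: commrX; apply/commr_sym/comm_dyadic_prod.
by apply: selfadjointD; [exact: star1|exact: selfadjointX].
Qed.

Lemma dyadic_prod_telescope a n :
  dyadic_prod a n * (1 - a ^+ 2) = 1 - a ^+ (2 ^ n.+1).
Proof.
rewrite /dyadic_prod.
elim: n => [|n IHn]; first by rewrite big_ord0 mul1r.
rewrite big_ord_recr /= -mulrA.
set b := a ^+ (2 ^ n.+1).
have -> : (1 + b) * (1 - a ^+ 2) = (1 - a ^+ 2) * (1 + b).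
  apply: commrB; first exact: commr1.
  apply/commr_sym/commrD; first exact: commr1.
  by apply: commrX; apply/commr_sym/commrX.
rewrite mulrA IHn -/b mulrDr mulr1 mulrBl mul1r addrA subrK.
by rewrite -exprD addnn -mul2n -expnS.
Qed.

Lemma norm1_le1 : `|(1 : A)| <= 1.
Proof.
have [->|n0] := eqVneq `|(1 : A)| 0; first exact: ler01.
rewrite -(ler_pM2r (_ : 0 < `|(1 : A)|)) ?lt_def ?n0 ?normr_ge0//.
by rewrite mul1r -expr2 -norm_sqr ?mulr1//; exact: star1.
Qed.

Lemma norm_expr_le1 a n : `|a| = 1 -> `|a ^+ n| <= 1.
Proof.
move=> a1; elim: n => [|n IHn]; first exact: norm1_le1.
by rewrite exprS (le_trans (norm_mul_le _ _))// a1 mul1r.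
Qed.

(** Powers of a selfadjoint element keep the norm: the square of
    [`|a ^+ n.+1|] is [`|a ^+ n * a ^+ n.+2|], which is at most
    [`|a ^+ n.+2|]. *)
Lemma norm_expr_ge1 a n : selfadjoint a -> `|a| = 1 -> 1 <= `|a ^+ n|.
Proof.
move=> sa a1; elim: n => [|n IHn].
  by have := norm_mul_le 1 a; rewrite mul1r a1 mulr1.
case: n IHn => [|n] IHn; first by rewrite expr1 a1.
have: 1 <= `|a ^+ n.+1| ^+ 2 by rewrite expr_ge1.
move=> /le_trans; apply; rewrite -norm_sqr; last exact: selfadjointX.
rewrite -exprD addSnnS exprD (le_trans (norm_mul_le _ _))//.
by rewrite ler_piMl// norm_expr_le1.
Qed.

(** Bounding the last factor below by [norm_mul_1Dsqr_ge] leaves behind a power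
    of [a]; the exponent [m] is there to absorb it in the induction. *)
Lemma norm_dyadic_prod_ge a m n : selfadjoint a -> `|a| = 1 ->
  2 ^+ n <= `|a ^+ m * dyadic_prod a n|.
Proof.
move=> sa a1; elim: n m => [|n IHn] m.
  by rewrite /dyadic_prod big_ord0 mulr1 expr0 norm_expr_ge1.
set b := a ^+ (2 ^ n); set y := a ^+ m * dyadic_prod a n.
have cay : GRing.comm a y.
  by apply: commrM; [apply: commrX|apply: comm_dyadic_prod].
have sy : selfadjoint y.
  apply: selfadjointM; [|exact: selfadjointX|exact: selfadjoint_dyadic_prod].
  by apply/commr_sym/commrX/commr_sym/comm_dyadic_prod.
have bb : b * b = a ^+ (2 ^ n.+1) by rewrite -exprD addnn -mul2n -expnS.
have yb : y * b = a ^+ (m + 2 ^ n) * dyadic_prod a n.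
  rewrite exprD -!mulrA; congr (_ * _).
  exact/commrX/commr_sym/comm_dyadic_prod.
rewrite /dyadic_prod big_ord_recr /= -/(dyadic_prod a n) mulrA -/y -bb.
rewrite (le_trans _ (norm_mul_1Dsqr_ge _ _ _))//; last 2 first.
- by apply/commr_sym/commrX/commr_sym.
- exact: selfadjointX.
by rewrite exprS yb ler_pM2l.
Qed.

(** A nonnegative element of [R[i]] is real, which brings the question down to
    the archimedean field [R]. *)
Lemma exists_expr2_gt (x : R[i]) : 0 <= x -> exists n, x < 2 ^+ n.
Proof.
move=> x0; rewrite -(RRe_real (ger0_real x0)).
have Rx0 : 0 <= complex.Re x by move: x0; rewrite lecE => /andP[].
exists (Num.bound (complex.Re x)).
rewrite -natrX -(rmorph_nat (real_complex R)) ltcR.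
apply: (lt_trans (archi_boundP Rx0)).
by rewrite ltr_nat ltn_expl.
Qed.

(** * Nonzero spectral values and antisymmetry of the order *)

(** Multiplying the telescoped product by the inverse [g] bounds
    [dyadic_prod a n] by [2 * `|g|] for all [n], against its growth. *)
Lemma not_invertible_1Bsqr a g : selfadjoint a -> `|a| = 1 ->
  (1 - a ^+ 2) * g <> 1.
Proof.
move=> sa a1 ag.
have [n] := exists_expr2_gt (mulr_ge0 (ler0n _ 2) (normr_ge0 g)).
move=> /(le_lt_trans _) lt_n.
suff /lt_n : 2 ^+ n <= 2 * `|g| by rewrite ltxx.
apply: (le_trans (norm_dyadic_prod_ge 0 n sa a1)).
rewrite expr0 mul1r -[dyadic_prod a n]mulr1 -ag mulrA dyadic_prod_telescope.
rewrite (le_trans (norm_mul_le _ _))// ler_wpM2r//.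
rewrite (le_trans (ler_normB _ _))// -[2]/(1 + 1).
by rewrite lerD ?norm1_le1 ?norm_expr_le1.
Qed.

(** With [t = `|a|], if neither [t] nor [- t] were in the spectrum, then
    [(t - a) (- t - a) = a ^+ 2 - t ^+ 2] would be invertible, and so would
    [1 - (a / t) ^+ 2]. *)
Lemma selfadjoint_spectrum0 a :
  selfadjoint a -> (forall l, spectrum a l -> l = 0) -> a = 0.
Proof.
move=> sa a_spec; apply/eqP/negPn/negP => a0.
set t := `|a|; have t0 : t != 0 by rewrite normr_eq0.
have inv l : l != 0 -> invertible (l *: (1 : A) - a).
  by move=> l0; apply: contrapT => /a_spec; apply/eqP.
have [b1 [tb1 _]] := inv t t0.
have [b2 [tb2 _]] : invertible (- t *: (1 : A) - a) by apply: inv; rewrite oppr_eq0.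
apply: (@not_invertible_1Bsqr (t^-1 *: a) (- (t ^+ 2) *: (b2 * b1))).
- by rewrite /selfadjoint /= starZ sa conj_Creal// realV normr_real.
- by rewrite normrZ normfV normr_id mulVf.
have -> : 1 - (t^-1 *: a) ^+ 2 =
    - (t ^+ 2)^-1 *: ((t *: (1 : A) - a) * (- t *: (1 : A) - a)).
  have -> : (t *: (1 : A) - a) * (- t *: (1 : A) - a) = a * a - t ^+ 2 *: (1 : A).
    rewrite mulrBr !mulrBl !mul_scalel !mul_scaler !mul1r mulr1 scalerA.
    by rewrite mulrN -expr2 !scaleNr opprB opprK addrC (addrC (- _)) addrA subrK.
  rewrite expr2 mul_scalel mul_scaler scalerA -invfM -expr2.
  by rewrite scaleNr -scalerN opprB scalerBr scalerA mulVf ?scale1r// expf_neq0.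
rewrite mul_scalel mul_scaler scalerA.
rewrite -mulrA (mulrA _ b2) tb2 mul1r tb1.
by rewrite mulrNN mulVf ?scale1r// expf_neq0.
Qed.

(** The spectrum of [- a] is the opposite of that of [a], so both lie in
    [{0}]. *)
Lemma positive_anti a : positive a -> positive (- a) -> a = 0.
Proof.
move=> [sa pa] [_ na]; apply: selfadjoint_spectrum0 => // l al.
apply/eqP; rewrite eq_le (pa l al) andbT -oppr_ge0.
apply: na => -[b [lb bl]]; apply: al; exists (- b).
have E : l *: (1 : A) - a = - (- l *: (1 : A) - - a).
  by rewrite opprD !opprK scaleNr opprK.
by rewrite E !mulrNN.
Qed.

End CStarAlgebra.

Theorem theorem6 (R : realType) (A : unitalCStarAlgType R) (X : Type)
    (d : X -> X -> A) (d_metric : cstar_metric d)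
    (x0 : X) (r : A) (r_pos : positive r)
    (phi : X -> A) (phiE : forall x : X, phi x = d x x0)
    (T : X -> X)
    (T_le : forall x : X, circle d x0 r x ->
       d x (T x) ⪯ phi x + phi (T x) - r *+ 2)
    (T_in : forall x : X, circle d x0 r x -> d (T x) x0 ⪯ r) :
  fixed_circle d x0 r T.
Proof.
move=> x xr; have dxr : d x x0 = r by [].
have [_ ge0 eq0 sym tri] := d_metric.
set p := d x (T x); set q := d (T x) x0.
have [_ _ p_pos] := ge0 x (T x); rewrite subr0 -/p in p_pos.
have [_ _ s_pos] := T_in x xr; rewrite -/q in s_pos.
have [_ _] := tri (T x) x0 x; rewrite dxr (sym (T x)) -/p -/q => ps_pos.
have [_ _] := T_le x xr; rewrite !phiE dxr -/p -/q => ps_neg.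
have ps0 : p + (r - q) = 0.
  apply: positive_anti; first by rewrite addrA.
  suff -> : - (p + (r - q)) = r + q - r *+ 2 - p by [].
  by rewrite opprD opprB addrC mulr2n opprD addrA (addrC r) addrK.
have p0 : p = 0.
  apply: positive_anti => //.
  by rewrite (addr0_eq ps0).
exact/esym/eq0.
Qed.
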